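(* Let $(d_n)_{n\ge1}$ be a sequence of natural numbers $d_n>1$, let $P=\|p_{i,n}\|$ be a matrix satisfying properties $1^\circ$–$4^\circ$ of the context, all of whose elements are non-negative, and let $\tilde F$ be the function on $[0;1]$ defined in the context. Then: (1) for every $n\in\mathbb N$ and all $c_j\in A_{d_j}$, $j=1,\dots,n$, the increment of $\tilde F$ on the cylinder $\Delta^{-(d_n)}_{c_1c_2\dots c_n}$ is $$\mu_{\tilde F}\left(\Delta^{-(d_n)}_{c_1c_2\dots c_n}\right)=\prod_{j=1}^n\tilde p_{c_j,j}\ge0;$$ (2) if $x_0=\Delta^{-(d_n)}_{\varepsilon_1\varepsilon_2\dots\varepsilon_n\dots}$ is a nega-$(d_n)$-irrational point, then $$\tilde F'(x_0)=\lim_{n\to\infty}\left(\prod_{j=1}^n d_j\tilde p_{\varepsilon_j,j}\right).$$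
   Context: Fix a sequence $(d_n)_{n\ge1}$ of natural numbers $d_n>1$; put $A_{d_n}=\{0,1,\dots,d_n-1\}$. Every $x\in[0;1]$ can be written as $$x=\Delta^{-(d_n)}_{\varepsilon_1\varepsilon_2\dots\varepsilon_n\dots}:=\sum_{n=1}^\infty\frac{1+\varepsilon_n}{d_1d_2\cdots d_n}(-1)^{n+1},\qquad \varepsilon_n=\varepsilon_n(x)\in A_{d_n}$$ (the nega-$(d_n)$-representation of $x$). Numbers having two different representations, $$\Delta^{-(d_n)}_{\varepsilon_1\dots\varepsilon_{n-1}\varepsilon_n[d_{n+1}-1]0[d_{n+3}-1]0\dots}=\Delta^{-(d_n)}_{\varepsilon_1\dots\varepsilon_{n-1}[\varepsilon_n-1]0[d_{n+2}-1]0[d_{n+4}-1]\dots},$$ are called nega-$(d_n)$-rational; all other numbers in $[0;1]$ have a unique representation and are called nega-$(d_n)$-irrational. The cylinder $\Delta^{-(d_n)}_{c_1c_2\dots c_n}$ is the closed interval of all numbers in $[0;1]$ having a nega-$(d_n)$-representation whose first $n$ digits are $c_1,\dots,c_n$. Its endpoints are $\Delta^{-(d_n)}_{c_1\dots c_n[d_{n+1}-1]0[d_{n+3}-1]0\dots}$ (left endpoint if $n$ is odd, right endpoint if $n$ is even) and $\Delta^{-(d_n)}_{c_1\dots c_n0[d_{n+2}-1]0[d_{n+4}-1]\dots}$ (right endpoint if $n$ is odd, left endpoint if $n$ is even). The increment $\mu_{\tilde F}$ on the cylinder is the value of $\tilde F$ at its right endpoint minus the value at its left endpoint. $P=\|p_{i,n}\|$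 ($n=1,2,\dots$; $i=0,1,\dots,d_n-1$) is a real matrix with the properties: $1^\circ$. $p_{i,n}\in(-1;1)$ for all $n\in\mathbb N$ and all $i$; $2^\circ$. $\sum_{i=0}^{d_n-1}p_{i,n}=1$ for all $n\in\mathbb N$; $3^\circ$. $\prod_{n=1}^\infty|p_{i_n,n}|=0$ for every sequence $(i_n)$ with $i_n\in A_{d_n}$; $4^\circ$. $\sum_{i=0}^{i_n-1}p_{i,n}>0$ for all $n$ and all $i_n\in A_{d_n}\setminus\{0\}$. Put $\beta_{0,n}=0$ and $\beta_{\varepsilon,n}=\sum_{i=0}^{\varepsilon-1}p_{i,n}$ for $\varepsilon\in A_{d_n}\setminus\{0\}$. For $\varepsilon\in A_{d_n}$ put $\tilde\beta_{\varepsilon,n}=\beta_{\varepsilon,n}$, $\tilde p_{\varepsilon,n}=p_{\varepsilon,n}$ if $n$ is odd, and $\tilde\beta_{\varepsilon,n}=\beta_{d_n-1-\varepsilon,n}$, $\tilde p_{\varepsilon,n}=p_{d_n-1-\varepsilon,n}$ if $n$ is even. The function $\tilde F$ on $[0;1]$ is defined, for $x=\Delta^{-(d_n)}_{\varepsilon_1\varepsilon_2\dots\varepsilon_n\dots}$, by $$\tilde F(x)=\beta_{\varepsilon_1(x),1}+\sum_{n=2}^\infty\left(\tilde\beta_{\varepsilon_n(x),n}\prod_{j=1}^{n-1}\tilde p_{\varepsilon_j(x),j}\right).$$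
   Formalization: In (2) the derivative of F̃ at x0 (relative to [0;1], finite or infinite) is assumed to exist; the limit is then proved to exist and equal it. Without this (2) fails: d_n=3, columns (1/6,1/3,1/2), x0=1/2 has limit 1 but no derivative. *)

(* Defs.v *)
From HB Require Import structures.
From mathcomp Require Import all_boot all_order all_algebra.
From mathcomp Require Import all_classical all_reals all_analysis.

Set Implicit Arguments.
Unset Strict Implicit.
Unset Printing Implicit Defensive.

Import Order.TTheory GRing.Theory Num.Theory.
Import numFieldNormedType.Exports.

Local Open Scope classical_set_scope.
Local Open Scope ring_scope.

(* Sequences and the columns of the matrix are indexed from 1, since the      *)
(* parity of the index matters; the values at index 0 are never used.         *)

Definition digit_seq (d eps : nat -> nat) : Prop :=
  forall n, (0 < n)%N -> (eps n < d n)%N.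

Definition nega_value (R : realType) (d eps : nat -> nat) : R :=
  limn (fun N : nat => \sum_(1 <= n < N)
    ((1 + eps n)%:R / (\prod_(1 <= k < n.+1) (d k)%:R) * (-1) ^+ n.+1) : R).

Definition nega_repr (R : realType) (d : nat -> nat) (x : R)
    (eps : nat -> nat) : Prop :=
  digit_seq d eps /\ x = nega_value R d eps.

(* Two representations differ when they differ at some index n >= 1. *)
Definition nega_rational (R : realType) (d : nat -> nat) (x : R) : Prop :=
  0 <= x <= 1 /\
  exists eps eps' : nat -> nat,
    [/\ nega_repr d x eps, nega_repr d x eps' &
        exists2 n, (0 < n)%N & eps n <> eps' n].

Definition nega_irrational (R : realType) (d : nat -> nat) (x : R) : Prop :=
  0 <= x <= 1 /\ ~ nega_rational d x.

Definition cylinder (R : realType) (d : nat -> nat) (n : nat)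
    (c : nat -> nat) : set R :=
  [set x | 0 <= x <= 1 /\
    exists2 eps, nega_repr d x eps &
      forall j, (0 < j <= n)%N -> eps j = c j].

Definition beta (R : realType) (p : nat -> nat -> R) (e n : nat) : R :=
  \sum_(0 <= i < e) p i n.

Definition tilde_beta (R : realType) (d : nat -> nat) (p : nat -> nat -> R)
    (e n : nat) : R :=
  if odd n then beta p e n else beta p (d n - 1 - e)%N n.

Definition tilde_p (R : realType) (d : nat -> nat) (p : nat -> nat -> R)
    (e n : nat) : R :=
  if odd n then p e n else p (d n - 1 - e)%N n.

(* The digits eps_n(x): some nega-(d_n)-representation of x. For a            *)
(* nega-(d_n)-rational x this is one of its two representations; they yield   *)
(* the same value of [tildeF] below. The default is only used when x has no   *)
(* representation, i.e. outside [0, 1].                                       *)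
Definition nega_digits (R : realType) (d : nat -> nat) (x : R) : nat -> nat :=
  xget (fun=> 0%N) [set eps : nat -> nat | nega_repr d x eps].

Definition tildeF (R : realType) (d : nat -> nat) (p : nat -> nat -> R)
    (x : R) : R :=
  let eps := nega_digits d x in
  beta p (eps 1%N) 1 +
  limn (fun N : nat => \sum_(2 <= n < N)
    (tilde_beta d p (eps n) n * \prod_(1 <= j < n) tilde_p d p (eps j) j) : R).

(* A cylinder is a closed interval, with endpoints its infimum and supremum. *)
Definition increment (R : realType) (f : R -> R) (I : set R) : R :=
  f (sup I) - f (inf I).

(* [has_derivative01 f x l]: the derivative at x of f, as a function on       *)
(* [0, 1] only (hence one-sided at 0 and 1, which are nega-(d_n)-irrational), *)
(* exists, finite or infinite, and equals l.                                  *)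
Definition has_derivative01 (R : realType) (f : R -> R) (x : R)
    (l : \bar R) : Prop :=
  ((f y - f x) / (y - x) : R)%:E @[y --> within `[0, 1]%classic x^'] --> l.

(* Main.v *)
Require Import Defs.
From HB Require Import structures.
From mathcomp Require Import all_boot all_order all_algebra.
From mathcomp Require Import all_classical all_reals all_analysis.
From mathcomp Require Import zify ring lra.

(** Replace every digit of even index by its complement
    [d n - 1 - eps n]. The signs then disappear: the nega-representation of [x]
    becomes its ordinary Cantor expansion, with digits [a = flip eps]
    ([nega_valueE]), and [tildeF] becomes
    [sum_n beta (a n) n * p (a 1) 1 * ... * p (a n.-1) n.-1] ([tildeFE]). The
    Cantor expansion is itself of this form, for the uniform weights [1 / d n],
    so both series are instances of [expansion w a]: the distribution function
    of a random number with independent digits, the [n]-th of law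
    [w _ n], read at the point with digits [a]. Every partial sum and its
    remainder then has a meaning: [left_mass w a N] and
    [left_mass w a N + mass w a N] are the values of the distribution function
    at the two ends of the cylinder of rank [N] around [a].

    The point that needs care is that [tildeF] is well defined at rational
    points. By [expansion_eq_trans], two digit sequences with the same Cantor
    expansion are equal or belong to the common end of two adjacent cylinders,
    and every system of weights gives the same value to both. Hence [tildeF] can
    be computed at the ends of a cylinder from the representations which continue
    the prefix by zeros or by maximal digits (after the flip), and its increment
    is the mass of the cylinder, the product of the [tilde_p].

    For the derivative, the product of the [d j * tilde_p] is the increment of
    [tildeF] over a cylinder of rank [n] divided by the length of the cylinder.
    It is a chord slope over an interval that contains [x0] and shrinks to it,
    so it lies between two difference quotients at [x0], and these tend to the
    derivative, finite or infinite ([straddle_slope_cvg]). *)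

Set Implicit Arguments.
Unset Strict Implicit.
Unset Printing Implicit Defensive.

Import Order.TTheory GRing.Theory Num.Theory.
Import numFieldNormedType.Exports.

Local Open Scope classical_set_scope.
Local Open Scope ring_scope.

(** * Expansions with respect to column weights *)

Section Expansion.
Variable R : realType.
Implicit Types (w : nat -> nat -> R) (a b d : nat -> nat).

Definition weights d w : Prop :=
  [/\ forall n i, (0 < n)%N -> (i < d n)%N -> 0 <= w i n,
      forall n, (0 < n)%N -> \sum_(0 <= i < d n) w i n = 1 &
      forall a, digit_seq d a ->
        \prod_(1 <= n < N.+1) w (a n) n @[N --> \oo] --> (0 : R)].

(** The measure of the cylinder of rank [N] around [a] when the digits are
    independent and the [n]-th digit is distributed according to the [n]-th
    column of [w]. *)
Definition mass w a N : R := \prod_(1 <= j < N.+1) w (a j) j.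

(** The measure of what lies to the left of that cylinder. *)
Definition left_mass w a N : R :=
  \sum_(1 <= n < N.+1) beta w (a n) n * \prod_(1 <= j < n) w (a j) j.

(** For the weights [1 / d n] this is the Cantor series
    [sum_n a n / (d 1 * ... * d n)]; for [p] it is the series of [tildeF]. *)
Definition expansion w a : R := limn (left_mass w a).

Lemma mass0 w a : mass w a 0 = 1.
Proof. by rewrite /mass big_geq. Qed.

Lemma massS w a N : mass w a N.+1 = mass w a N * w (a N.+1) N.+1.
Proof. by rewrite /mass big_nat_recr. Qed.

Lemma left_mass0 w a : left_mass w a 0 = 0.
Proof. by rewrite /left_mass big_geq. Qed.

Lemma left_massS w a N :
  left_mass w a N.+1 = left_mass w a N + beta w (a N.+1) N.+1 * mass w a N.
Proof. by rewrite /left_mass big_nat_recr. Qed.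

Lemma eq_mass w a b N : (forall j, (0 < j <= N)%N -> a j = b j) ->
  mass w a N = mass w b N.
Proof. by move=> ab; apply: eq_big_nat => j jN; rewrite ab. Qed.

Lemma eq_left_mass w a b N : (forall j, (0 < j <= N)%N -> a j = b j) ->
  left_mass w a N = left_mass w b N.
Proof.
move=> ab; apply: eq_big_nat => j /[dup] jN /andP[j0 jN'].
rewrite ab //; congr (_ * _); apply: eq_big_nat => i /andP[i0 ij].
by rewrite ab // i0 /= (leq_trans (ltnW ij)).
Qed.

Lemma eq_expansion w a b : (forall j, (0 < j)%N -> a j = b j) ->
  expansion w a = expansion w b.
Proof.
move=> ab; rewrite /expansion (_ : left_mass w a = left_mass w b) //.
by apply/funext => N; apply: eq_left_mass => j /andP[j0 _]; exact: ab.
Qed.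

Lemma beta0 w n : beta w 0 n = 0.
Proof. by rewrite /beta big_geq. Qed.

Lemma betaS w k n : beta w k.+1 n = beta w k n + w k n.
Proof. by rewrite /beta big_nat_recr. Qed.

Section Weights.
Variables (d : nat -> nat) (w : nat -> nat -> R).
Hypothesis wP : weights d w.

Let w_ge0 n i : (0 < n)%N -> (i < d n)%N -> 0 <= w i n.
Proof. by case: wP => h _ _ /h; apply. Qed.

Lemma beta_full n : (0 < n)%N -> beta w (d n) n = 1.
Proof. by case: wP => _ h _ /h. Qed.

Lemma ler_beta n k m : (0 < n)%N -> (k <= m)%N -> (m <= d n)%N ->
  beta w k n <= beta w m n.
Proof.
move=> n0 km md; rewrite /beta (big_cat_nat (n := k) (p := m)) //=.
rewrite lerDl big_nat; apply: sumr_ge0 => i /andP[_ im].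
by apply: w_ge0 => //; exact: leq_trans im md.
Qed.

Variable a : nat -> nat.
Hypothesis ad : digit_seq d a.

Lemma mass_ge0 N : 0 <= mass w a N.
Proof.
by rewrite /mass big_nat; apply: prodr_ge0 => i /andP[i0 _]; rewrite w_ge0 ?ad.
Qed.

Lemma left_mass_homo : {homo left_mass w a : m n / (m <= n)%N >-> m <= n}.
Proof.
apply/nondecreasing_seqP => N; rewrite left_massS lerDl mulr_ge0 ?mass_ge0 //.
by rewrite -(beta0 w N.+1) ler_beta // ltnW // ad.
Qed.

(** The right end of a cylinder moves left, since [beta (e + 1) n <= 1] for a
    digit [e]. *)
Lemma right_mass_homo :
  {homo (fun N => left_mass w a N + mass w a N) :
    m n / (m <= n)%N >-> n <= m}.
Proof.
apply/nonincreasing_seqP => N; rewrite left_massS massS -addrA lerD2l.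
rewrite [mass w a N * _]mulrC -mulrDl -betaS ler_piMl ?mass_ge0 //.
by rewrite -(beta_full (n := N.+1)) // ler_beta // ad.
Qed.

Lemma cvg_mass : mass w a N @[N --> \oo] --> (0 : R).
Proof. by case: wP => _ _; apply. Qed.

Lemma is_cvg_left_mass : cvgn (left_mass w a).
Proof.
apply: nondecreasing_is_cvgn; first exact: left_mass_homo.
exists 1 => _ [N _ <-]; apply: (@le_trans _ _ (left_mass w a N + mass w a N)).
  by rewrite lerDl mass_ge0.
by apply: le_trans (right_mass_homo (leq0n N)) _; rewrite left_mass0 mass0 add0r.
Qed.

(** The mass of a cylinder is the gap between its two ends, so both ends
    converge to the expansion and bound it on either side. *)
Lemma cvg_right_mass :
  left_mass w a N + mass w a N @[N --> \oo] --> expansion w a.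
Proof.
rewrite -[X in _ --> X]addr0; apply: cvgD; last exact: cvg_mass.
exact: is_cvg_left_mass.
Qed.

Lemma left_mass_le N : left_mass w a N <= expansion w a.
Proof.
by apply: nondecreasing_cvgn_le; [exact: left_mass_homo|exact: is_cvg_left_mass].
Qed.

Lemma le_right_mass N : expansion w a <= left_mass w a N + mass w a N.
Proof.
rewrite -(cvg_lim _ cvg_right_mass) //.
apply: (nonincreasing_cvgn_ge right_mass_homo).
by apply/cvg_ex; exists (expansion w a); exact: cvg_right_mass.
Qed.

Lemma expansion_itv : 0 <= expansion w a <= 1.
Proof.
have := left_mass_le 0; have := le_right_mass 0.
by rewrite left_mass0 mass0 add0r => -> ->.
Qed.

(** Every later cylinder keeps the same left end. *)
Lemma expansion_zero_tail N : (forall j, (N < j)%N -> a j = 0%N) ->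
  expansion w a = left_mass w a N.
Proof.
move=> a0; apply: cvg_lim => //; rewrite -(cvg_shiftn N).
rewrite [X in X @ _ --> _](_ : _ = cst (left_mass w a N)); first exact: cvg_cst.
apply/funext; elim=> [|n /= IH] /=; first by rewrite add0n.
by rewrite addSn left_massS IH a0 ?ltnS ?leq_addl// beta0 mul0r addr0.
Qed.

(** Every later cylinder keeps the same right end. *)
Lemma expansion_max_tail N : (forall j, (N < j)%N -> (a j).+1 = d j) ->
  expansion w a = left_mass w a N + mass w a N.
Proof.
move=> am; rewrite -(cvg_lim _ cvg_right_mass) //.
apply: cvg_lim => //; rewrite -(cvg_shiftn N).
rewrite [X in X @ _ --> _](_ : _ = cst (left_mass w a N + mass w a N)).
  exact: cvg_cst.
apply/funext; elim=> [|n /= IH] /=; first by rewrite add0n.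
rewrite addSn left_massS massS [mass w a _ * _]mulrC -addrA -mulrDl -betaS.
by rewrite am ?ltnS ?leq_addl// beta_full // mul1r.
Qed.

End Weights.

(** Every cylinder then has positive mass, so an expansion equal to an end of
    one of its cylinders has its remaining digits determined. *)
Definition pos_weights d w : Prop :=
  weights d w /\ forall n i, (0 < n)%N -> (i < d n)%N -> 0 < w i n.

Section PosWeights.
Variables (d : nat -> nat) (w : nat -> nat -> R).
Hypothesis wP : pos_weights d w.
Let wP1 : weights d w. Proof. by case: wP. Qed.

Lemma ltr_beta n k m : (0 < n)%N -> (k < m)%N -> (m <= d n)%N ->
  beta w k n < beta w m n.
Proof.
move=> n0 km md; apply: lt_le_trans (ler_beta wP1 n0 km md).
by rewrite betaS ltrDl; apply: wP.2 => //; exact: leq_trans km md.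
Qed.

Variable a : nat -> nat.
Hypothesis ad : digit_seq d a.

Lemma mass_gt0 N : 0 < mass w a N.
Proof.
by rewrite /mass big_nat; apply: prodr_gt0 => i /andP[i0 _]; rewrite wP.2 ?ad.
Qed.

(** A later nonzero digit would move the left end strictly to the right. *)
Lemma zero_tail_of_left N : expansion w a = left_mass w a N ->
  forall j, (N < j)%N -> a j = 0%N.
Proof.
move=> e [//|j] Nj; apply/eqP; rewrite -leqn0 leqNgt; apply/negP => aj0.
have := left_mass_le wP1 ad j.+1; rewrite leNgt => /negP; apply.
rewrite e left_massS; apply: le_lt_trans (left_mass_homo wP1 ad _) _.
  exact: Nj.
by rewrite ltrDl mulr_gt0 ?mass_gt0 // -(beta0 w j.+1) ltr_beta // ltnW // ad.
Qed.

(** A later digit below the maximum would move the right end strictly to the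
    left. *)
Lemma max_tail_of_right N : expansion w a = left_mass w a N + mass w a N ->
  forall j, (N < j)%N -> (a j).+1 = d j.
Proof.
move=> e [//|j] Nj; apply/eqP; rewrite eqn_leq ad //= leqNgt; apply/negP => aj.
have := le_right_mass wP1 ad j.+1; rewrite leNgt => /negP; apply.
rewrite e; apply: lt_le_trans (right_mass_homo wP1 ad (_ : (N <= j)%N)) => //.
rewrite left_massS massS [mass w a _ * _]mulrC -addrA -mulrDl -betaS ltrD2l.
by rewrite gtr_pMl ?mass_gt0 // -(beta_full wP1 (n := j.+1)) // ltr_beta.
Qed.

End PosWeights.

(** Let [a] and [b] first differ at index [m.+1], with [a m.+1 < b m.+1].
    The cylinder of [a] of rank [m.+1] lies to the left of that of [b], so the
    common value for [v] is the right end of the first and the left end of the second,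
    and the two cylinders are adjacent. Hence [a] continues with maximal digits,
    [b] with zeros, and [b m.+1] is the successor of [a m.+1]; any other system
    of weights then gives both digit sequences the same value. *)
Lemma expansion_eq_trans d v w a b : pos_weights d v -> weights d w ->
  digit_seq d a -> digit_seq d b ->
  expansion v a = expansion v b -> expansion w a = expansion w b.
Proof.
move=> vP wP ad bd vab.
have [ex|nex] := pselect (exists j, (0 < j)%N && (a j != b j)); last first.
  apply: eq_expansion => j j0; apply/eqP/negPn/negP => ab.
  by apply: nex; exists j; rewrite j0.
have {ex} [[//|m] /andP[_ abm] min] := ex_minnP ex.
have pre j : (0 < j <= m)%N -> a j = b j.
  move=> /andP[j0 jm]; apply/eqP/negPn/negP => ab.
  by have := min j; rewrite j0 ab => /(_ isT); rewrite leqNgt ltnS jm.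
wlog lt_ab : a b ad bd vab abm pre {min} / (a m.+1 < b m.+1)%N.
  move=> W; case: (ltngtP (a m.+1) (b m.+1)) => ab.
  - exact: W.
  - by apply/esym/W => //; [rewrite eq_sym|move=> j /pre ->].
  - by rewrite ab eqxx in abm.
have vP1 : weights d v by case: vP.
have lE u : left_mass u a m = left_mass u b m by exact: eq_left_mass.
have mE u : mass u a m = mass u b m by exact: eq_mass.
have rE u : left_mass u a m.+1 + mass u a m.+1 =
    left_mass u b m + beta u (a m.+1).+1 m.+1 * mass u b m.
  by rewrite left_massS massS lE mE [mass u b m * _]mulrC -addrA -mulrDl -betaS.
have bm : (b m.+1 <= d m.+1)%N by rewrite ltnW // bd.
(* The cylinder of [a] lies to the left of that of [b]. *)
have le_rl : left_mass v a m.+1 + mass v a m.+1 <= left_mass v b m.+1.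
  by rewrite rE left_massS lerD2l ler_wpM2r ?(mass_ge0 vP1) // (ler_beta vP1).
have va := le_right_mass vP1 ad m.+1.
have vb := left_mass_le vP1 bd m.+1.
have ea : expansion v a = left_mass v a m.+1 + mass v a m.+1.
  by apply/eqP; rewrite eq_le va vab (le_trans le_rl).
have eb : expansion v b = left_mass v b m.+1.
  by apply/eqP; rewrite eq_le vb -vab (le_trans va).
(* A gap of at least two digits would leave a cylinder of positive mass
   between the two. *)
have succ : (a m.+1).+1 = b m.+1.
  apply/eqP; rewrite eqn_leq lt_ab /= leqNgt; apply/negP => lt.
  suff : left_mass v a m.+1 + mass v a m.+1 < left_mass v b m.+1.
    by rewrite -ea -eb vab ltxx.
  by rewrite rE left_massS ltrD2l ltr_pM2r ?(mass_gt0 vP) // (ltr_beta vP).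
rewrite (expansion_max_tail wP ad (max_tail_of_right vP ad ea)).
by rewrite (expansion_zero_tail w (zero_tail_of_left vP bd eb)) rE succ left_massS.
Qed.

End Expansion.

(** * From alternating to ordinary expansions *)

Section Nega.
Variable R : realType.
Variable d : nat -> nat.
Hypothesis d_gt1 : forall n, (0 < n)%N -> (1 < d n)%N.
Implicit Types (eps a : nat -> nat) (x : R).

Definition flip eps : nat -> nat :=
  fun n => if odd n then eps n else (d n - 1 - eps n)%N.

(** Their expansion is the position of a point in [[0, 1]] itself, and the mass
    of a cylinder is its length. *)
Definition uniform_weight (i n : nat) : R := (d n)%:R^-1.

Let d_neq0 n : (0 < n)%N -> (d n)%:R != 0 :> R.
Proof. by move=> n0; rewrite pnatr_eq0 -lt0n ltnW // d_gt1. Qed.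

Lemma flip_digit eps : digit_seq d eps -> digit_seq d (flip eps).
Proof.
move=> ed n n0; rewrite /flip; case: ifP => _; first exact: ed.
have := d_gt1 n0; lia.
Qed.

Lemma flipK eps n : digit_seq d eps -> (0 < n)%N -> flip (flip eps) n = eps n.
Proof.
move=> ed n0; rewrite /flip; have := ed _ n0; case: (odd n) => //; lia.
Qed.

Lemma beta_uniform k n : beta uniform_weight k n = k%:R / (d n)%:R.
Proof. by rewrite /beta sumr_const_nat subn0 mulr_natl. Qed.

Lemma mass_uniform a N :
  mass uniform_weight a N = (\prod_(1 <= k < N.+1) (d k)%:R)^-1.
Proof. by rewrite /mass prodfV. Qed.

Lemma mass_uniform_le a N : mass uniform_weight a N <= 2^-1 ^+ N.
Proof.
elim: N => [|N IH]; first by rewrite mass0 expr0.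
rewrite massS exprSr ler_pM //.
- rewrite mass_uniform invr_ge0; apply: prodr_ge0 => i _; exact: ler0n.
- by rewrite /uniform_weight invr_ge0.
- rewrite /uniform_weight lef_pV2 ?posrE ?ltr0n ?ler_nat ?d_gt1 //.
  by rewrite ltnW // d_gt1.
Qed.

Lemma cvg_mass_uniform a :
  mass uniform_weight a N @[N --> \oo] --> (0 : R).
Proof.
apply: (@squeeze_cvgr _ _ _ _ (cst 0) (GRing.exp (2^-1 : R))).
- apply: nearW => N; rewrite mass_uniform_le andbT mass_uniform invr_ge0.
  by apply: prodr_ge0 => i _; exact: ler0n.
- exact: cvg_cst.
- by apply: cvg_expr; rewrite ger0_norm; lra.
Qed.

Lemma uniform_pos_weights : pos_weights d uniform_weight.
Proof.
have w_gt0 n i : (0 < n)%N -> 0 < uniform_weight i n.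
  by move=> n0; rewrite invr_gt0 ltr0n ltnW // d_gt1.
split=> //; last by move=> n i n0 _; exact: w_gt0.
split=> [n i n0 _|n n0|a _]; first exact/ltW/w_gt0.
- by rewrite -/(beta _ _ _) beta_uniform divff // d_neq0.
- exact: cvg_mass_uniform.
Qed.

Let uniform_weights : weights d uniform_weight.
Proof. exact: uniform_pos_weights.1. Qed.

(** With [a = flip eps], an even index contributes
    [- (1 + eps n) / D_n = a n / D_n - 1 / D_(n - 1)], where
    [D_n = d 1 * ... * d n], and an odd one contributes
    [a n / D_n + 1 / D_n]; the corrections telescope. *)
Lemma nega_sumE eps N : digit_seq d eps ->
  \sum_(1 <= n < N.+1)
    ((1 + eps n)%:R / (\prod_(1 <= k < n.+1) (d k)%:R) * (-1) ^+ n.+1) =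
  left_mass uniform_weight (flip eps) N +
    (if odd N then mass uniform_weight (flip eps) N else 0) :> R.
Proof.
move=> ed; elim: N => [|N IH]; first by rewrite big_geq // left_mass0 addr0.
rewrite big_nat_recr //= IH left_massS massS -(mass_uniform (flip eps)) massS.
rewrite -signr_odd /= beta_uniform [flip eps N.+1]/flip /= /uniform_weight.
set M := mass _ _ _; have dn0 := d_neq0 (ltn0Sn N).
have edN : (eps N.+1 < d N.+1)%N by exact: ed.
case: (odd N) => /=; last by rewrite !natrD; field.
have -> : (d N.+1 - 1 - eps N.+1)%:R = (d N.+1)%:R - 1 - (eps N.+1)%:R :> R.
  by rewrite !natrB //; lia.
by rewrite natrD; field.
Qed.

Lemma nega_valueE eps : digit_seq d eps ->
  nega_value R d eps = expansion uniform_weight (flip eps).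
Proof.
move=> ed; have fd := flip_digit ed; apply: cvg_lim => //.
rewrite -cvg_shiftS.
(* The partial sums of the alternating series are, alternately, the left and
   the right ends of the cylinders. *)
apply: (@squeeze_cvgr _ _ _ _ (left_mass uniform_weight (flip eps))
  (fun N => left_mass uniform_weight (flip eps) N +
            mass uniform_weight (flip eps) N)).
- apply: nearW => N; rewrite /= nega_sumE // lerDl lerD2l.
  by case: ifP; rewrite ?lexx (mass_ge0 uniform_weights).
- exact: is_cvg_left_mass uniform_weights _ fd.
- exact: cvg_right_mass uniform_weights _ fd.
Qed.

Lemma nega_repr_itv x eps : nega_repr d x eps -> 0 <= x <= 1.
Proof.
by case=> ed ->; rewrite nega_valueE // (expansion_itv uniform_weights) //;
  exact: flip_digit.
Qed.

Lemma tilde_betaE (p : nat -> nat -> R) eps n :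
  tilde_beta d p (eps n) n = beta p (flip eps n) n.
Proof. by rewrite /tilde_beta /flip; case: ifP. Qed.

Lemma tilde_pE (p : nat -> nat -> R) eps n :
  tilde_p d p (eps n) n = p (flip eps n) n.
Proof. by rewrite /tilde_p /flip; case: ifP. Qed.

Lemma prod_tilde_pE (p : nat -> nat -> R) eps n :
  \prod_(1 <= j < n.+1) tilde_p d p (eps j) j = mass p (flip eps) n.
Proof. by apply: eq_bigr => j _; rewrite tilde_pE. Qed.

Section Distribution.
Variable p : nat -> nat -> R.
Hypothesis pP : weights d p.

(** The value of [tildeF] does not depend on the representation, because two
    representations of a point have the same uniform expansion. *)
Lemma tildeFE x eps : nega_repr d x eps ->
  tildeF d p x = expansion p (flip eps).
Proof.
move=> xe; rewrite /tildeF.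
have : nega_repr d x (nega_digits d x) by apply: xgetPex; exists eps.
set dig := nega_digits d x => xd.
have [[ed xE] [dd xE']] := (xe, xd).
rewrite -(expansion_eq_trans uniform_pos_weights pP
  (flip_digit dd) (flip_digit ed)); last by rewrite -!nega_valueE // -xE -xE'.
have fd := flip_digit dd.
apply/esym/cvg_lim => //.
set s := (X in limn X).
(* The term of index 1 stands outside the series that defines [tildeF]. *)
have sE N : s N.+2 = left_mass p (flip dig) N.+1 - beta p (dig 1%N) 1.
  rewrite /left_mass big_nat_recl // (big_geq (leqnn 1)) mulr1 addrC.
  rewrite [flip dig 1%N]/flip /= addKr /s !big_add1 /=.
  apply: eq_bigr => n _; rewrite tilde_betaE; congr (_ * _).
  by apply: eq_bigr => j _; rewrite tilde_pE.
have sc : s N @[N --> \oo] --> expansion p (flip dig) - beta p (dig 1%N) 1.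
  rewrite -cvg_shiftS -cvg_shiftS.
  rewrite [X in X @ _ --> _](_ : _ =
      fun N => left_mass p (flip dig) N.+1 - beta p (dig 1%N) 1); last first.
    by apply/funext => N /=; rewrite sE.
  apply: cvgB; last exact: cvg_cst.
  by rewrite cvg_shiftS; exact: is_cvg_left_mass pP _ fd.
rewrite (cvg_lim _ sc) // addrC subrK.
exact: is_cvg_left_mass pP _ fd.
Qed.

End Distribution.

(** * Cylinders *)

Definition cyl_left eps n : R := left_mass uniform_weight (flip eps) n.
Definition cyl_right eps n : R :=
  left_mass uniform_weight (flip eps) n + mass uniform_weight (flip eps) n.

Section Endpoints.
Variables (n : nat) (c : nat -> nat).
Hypothesis cd : forall j, (0 < j <= n)%N -> (c j < d j)%N.

Lemma flip_prefix eps : (forall j, (0 < j <= n)%N -> eps j = c j) ->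
  forall j, (0 < j <= n)%N -> flip eps j = flip c j.
Proof. by move=> ec j jn; rewrite /flip ec. Qed.

(** The digits of the left endpoint come from undoing the flip on the first
    [n] terms of [flip c] continued by zeros. *)
Lemma cyl_left_repr : exists eps,
  [/\ nega_repr d (cyl_left c n) eps,
      forall j, (0 < j <= n)%N -> eps j = c j &
      forall p, weights d p -> tildeF d p (cyl_left c n) =
        left_mass p (flip c) n].
Proof.
pose a j := if (j <= n)%N then flip c j else 0%N.
have ad : digit_seq d a.
  move=> j j0; rewrite /a; case: ifP => jn; last by rewrite ltnW // d_gt1.
  rewrite /flip; have := d_gt1 j0; have := @cd j.
  by rewrite j0 jn => /(_ isT); case: ifP => _; lia.
have fd := flip_digit ad.
have aE w : expansion w (flip (flip a)) = left_mass w (flip c) n.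
  rewrite (@eq_expansion _ _ _ a); last by move=> j; exact: flipK.
  rewrite (@expansion_zero_tail _ w a n); last first.
    by move=> j jn; rewrite /a leqNgt jn.
  by apply: eq_left_mass => j /andP[_ jn]; rewrite /a jn.
have repr : nega_repr d (cyl_left c n) (flip a).
  by split=> //; rewrite nega_valueE // aE.
exists (flip a); split => // [j /andP[j0 jn]|p pP]; last first.
  by rewrite (tildeFE pP repr) aE.
have := @cd j; rewrite j0 jn => /(_ isT) cj.
by rewrite /flip /a jn /flip; case: (odd j) => //; lia.
Qed.

(** The same with maximal digits, for the right endpoint. *)
Lemma cyl_right_repr : exists eps,
  [/\ nega_repr d (cyl_right c n) eps,
      forall j, (0 < j <= n)%N -> eps j = c j &
      forall p, weights d p -> tildeF d p (cyl_right c n) =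
        left_mass p (flip c) n + mass p (flip c) n].
Proof.
pose a j := if (j <= n)%N then flip c j else (d j - 1)%N.
have ad : digit_seq d a.
  move=> j j0; rewrite /a; have := d_gt1 j0; case: ifP => jn; last lia.
  rewrite /flip; have := @cd j.
  by rewrite j0 jn => /(_ isT); case: ifP => _; lia.
have fd := flip_digit ad.
have aE w : weights d w ->
    expansion w (flip (flip a)) = left_mass w (flip c) n + mass w (flip c) n.
  move=> wP; rewrite (@eq_expansion _ _ _ a); last by move=> j; exact: flipK.
  rewrite (@expansion_max_tail _ _ _ wP _ ad n); last first.
    move=> j jn; rewrite /a leqNgt jn /=; have := @d_gt1 j; lia.
  by congr (_ + _); [apply: eq_left_mass|apply: eq_mass] => j /andP[_ jn];
    rewrite /a jn.
have repr : nega_repr d (cyl_right c n) (flip a).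
  by split=> //; rewrite nega_valueE // aE.
exists (flip a); split => // [j /andP[j0 jn]|p pP]; last first.
  by rewrite (tildeFE pP repr) aE.
have := @cd j; rewrite j0 jn => /(_ isT) cj.
by rewrite /flip /a jn /flip; case: (odd j) => //; lia.
Qed.

Lemma cylinder_itv x : cylinder d n c x -> cyl_left c n <= x <= cyl_right c n.
Proof.
case=> _ [eps [ed ->] ec]; have fd := flip_digit ed.
rewrite nega_valueE // /cyl_right /cyl_left.
have fc := flip_prefix ec.
rewrite -(eq_left_mass _ fc) -(eq_mass _ fc).
by rewrite (left_mass_le uniform_weights) // (le_right_mass uniform_weights).
Qed.

Lemma cyl_left_in : cylinder d n c (cyl_left c n).
Proof.
have [eps [xe ec _]] := cyl_left_repr.
by split; [exact: nega_repr_itv xe|exists eps].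
Qed.

Lemma cyl_right_in : cylinder d n c (cyl_right c n).
Proof.
have [eps [xe ec _]] := cyl_right_repr.
by split; [exact: nega_repr_itv xe|exists eps].
Qed.

Lemma inf_cylinder : inf (cylinder d n c) = cyl_left c n.
Proof.
have lb : lbound (cylinder d n c) (cyl_left c n).
  by move=> y /cylinder_itv /andP[].
apply/eqP; rewrite eq_le; apply/andP; split.
  by apply: ge_inf; [exists (cyl_left c n)|exact: cyl_left_in].
by apply: lb_le_inf => //; exists (cyl_left c n); exact: cyl_left_in.
Qed.

Lemma sup_cylinder : sup (cylinder d n c) = cyl_right c n.
Proof.
have ub : ubound (cylinder d n c) (cyl_right c n).
  by move=> y /cylinder_itv /andP[].
apply/eqP; rewrite eq_le; apply/andP; split.
  by apply: ge_sup => //; exists (cyl_right c n); exact: cyl_right_in.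
by apply: ub_le_sup; [exists (cyl_right c n)|exact: cyl_right_in].
Qed.

Lemma tildeF_increment (p : nat -> nat -> R) : weights d p ->
  tildeF d p (cyl_right c n) - tildeF d p (cyl_left c n) = mass p (flip c) n.
Proof.
move=> pP; have [_ [_ _ ->//]] := cyl_right_repr.
have [_ [_ _ ->//]] := cyl_left_repr.
by rewrite addrC addKr.
Qed.

End Endpoints.
End Nega.

(** * Straddling difference quotients *)

Section Straddle.
Variable R : realType.
Implicit Types (f : R -> R) (x l r : R).

(** A chord over [[l, r]] has slope a convex combination of the slopes of the
    chords from an intermediate point [x] to [l] and to [r]. *)
Lemma exists_smaller_slope f x l r : l <= x <= r -> l < r ->
  exists y, [/\ y \in [:: l; r], y != x &
    (f y - f x) / (y - x) <= (f r - f l) / (r - l)].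
Proof.
move=> /andP[lx xr] lr.
have [->|nlx] := eqVneq x l.
  by exists r; rewrite !inE eqxx orbT gt_eqF.
have [->|nxr] := eqVneq x r.
  exists l; split; [by rewrite inE eqxx|by rewrite lt_eqF|].
  by rewrite -(opprB (f r)) -(opprB r) invrN mulrNN.
have {nlx} lx' : l < x by rewrite lt_neqAle eq_sym nlx.
have {nxr} xr' : x < r by rewrite lt_neqAle nxr.
(* If the slope towards [r] is too large, the slope towards [l] is not. *)
have [le|gt] := leP ((f r - f x) / (r - x)) ((f r - f l) / (r - l)).
  by exists r; rewrite !inE eqxx orbT gt_eqF.
exists l; split; [by rewrite inE eqxx|by rewrite lt_eqF|].
rewrite -(opprB (f x)) -(opprB x) invrN mulrNN.
have e1 : f r - f x = (f r - f x) / (r - x) * (r - x).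
  by rewrite divfK // subr_eq0 gt_eqF.
have e2 : f r - f l = (f r - f l) / (r - l) * (r - l).
  by rewrite divfK // subr_eq0 gt_eqF.
rewrite ler_pdivrMr ?subr_gt0 //.
set s := _ / (r - x) in gt e1; set q := _ / (r - l) in gt e2 *.
nra.
Qed.

(** The previous lemma for [- f]. *)
Lemma exists_larger_slope f x l r : l <= x <= r -> l < r ->
  exists y, [/\ y \in [:: l; r], y != x &
    (f r - f l) / (r - l) <= (f y - f x) / (y - x)].
Proof.
move=> lxr lr.
have [y [yI yx]] := exists_smaller_slope (fun z => - f z) lxr lr.
by rewrite -!opprD !mulNr lerN2 => le; exists y.
Qed.

(** The interval [[l n, r n]] may have [x] as an end, as happens at 0 and 1;
    only the other end then enters the squeeze. *)
Lemma straddle_slope_cvg f x (l r : nat -> R) (D : \bar R) :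
  has_derivative01 f x D ->
  (forall n, 0 <= l n /\ r n <= 1) ->
  (forall n, l n <= x <= r n) -> (forall n, l n < r n) ->
  r n - l n @[n --> \oo] --> (0 : R) ->
  ((f (r n) - f (l n)) / (r n - l n))%:E @[n --> \oo] --> D.
Proof.
move=> fD lr01 lxr lr rl0.
have slope_cvg (y : nat -> R) :
    (forall n, y n \in [:: l n; r n]) -> (forall n, y n != x) ->
    ((f (y n) - f x) / (y n - x))%:E @[n --> \oo] --> D.
  move=> ylr yx.
  have bounds n : l n <= y n <= r n.
    have := ylr n; rewrite !inE => /orP[]/eqP ->; rewrite lexx ?andbT ltW //=.
  have yxc : y n @[n --> \oo] --> x.
    apply/cvgrPdist_lt => e e0.
    move/cvgrPdist_lt: rl0 => /(_ e e0); apply: filterS => n.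
    rewrite sub0r normrN ger0_norm ?subr_ge0 ?(ltW (lr n)) //.
    apply: le_lt_trans; rewrite ler_norml.
    by have := bounds n; have := lxr n; lra.
  apply: (@cvg_comp _ _ _ y (fun z => ((f z - f x) / (z - x))%:E) _ _ _ _ fD).
  move=> A /= [e e0 eA].
  move/cvgrPdist_lt: yxc => /(_ e e0); apply: filterS => n xyn.
  apply: (eA (y n) xyn (yx n)) => /=; rewrite in_itv /=.
  by have := bounds n; have := lr01 n; lra.
have /choice[y yP] := fun n => exists_smaller_slope f (lxr n) (lr n).
have /choice[z zP] := fun n => exists_larger_slope f (lxr n) (lr n).
apply: (squeeze_cvge _ (slope_cvg y _ _) (slope_cvg z _ _)).
- apply: nearW => n; rewrite !lee_fin.
  by have [_ _ ->] := yP n; have [_ _ ->] := zP n.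
- by move=> n; case: (yP n).
- by move=> n; case: (yP n).
- by move=> n; case: (zP n).
- by move=> n; case: (zP n).
Qed.

End Straddle.

(** * Increments and derivative *)

Theorem mainTheorem6 (R : realType) (d : nat -> nat) (p : nat -> nat -> R)
  (d_gt1 : forall n, (0 < n)%N -> (1 < d n)%N)
  (p_bounds : forall n i, (0 < n)%N -> (i < d n)%N -> -1 < p i n < 1)
  (p_sum1 : forall n, (0 < n)%N -> \sum_(0 <= i < d n) p i n = 1)
  (p_prod0 : forall e : nat -> nat, digit_seq d e ->
     \prod_(1 <= n < N.+1) `|p (e n) n| @[N --> \oo] --> (0 : R))
  (p_partial : forall n k, (0 < n)%N -> (0 < k < d n)%N ->
     0 < \sum_(0 <= i < k) p i n)
  (p_ge0 : forall n i, (0 < n)%N -> (i < d n)%N -> 0 <= p i n) :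
  (forall (n : nat) (c : nat -> nat), (0 < n)%N ->
     (forall j, (0 < j <= n)%N -> (c j < d j)%N) ->
     increment (tildeF d p) (cylinder d n c)
       = \prod_(1 <= j < n.+1) tilde_p d p (c j) j
     /\ 0 <= \prod_(1 <= j < n.+1) tilde_p d p (c j) j)
  /\
  (forall (x0 : R) (eps : nat -> nat),
     nega_repr d x0 eps -> nega_irrational d x0 ->
     forall l : \bar R, has_derivative01 (tildeF d p) x0 l ->
       (\prod_(1 <= j < n.+1) ((d j)%:R * tilde_p d p (eps j) j) : R)%:E
         @[n --> \oo] --> l).
Proof.
have pP : weights d p.
  split=> // a ad; have := p_prod0 a ad.
  rewrite [X in X @ _ --> _](_ : _ =
    fun N => \prod_(1 <= n < N.+1) p (a n) n); first by [].
  apply/funext => N; apply: eq_big_nat => n /andP[n0 _].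
  by rewrite ger0_norm // p_ge0 // ad.
split=> [n c n0 cd|x0 eps [ed x0E] _ l fl].
  rewrite /increment sup_cylinder // inf_cylinder // tildeF_increment //.
  rewrite prod_tilde_pE; split=> //.
  rewrite -prod_tilde_pE big_nat; apply: prodr_ge0 => j /andP[j0 jn].
  have := cd j; rewrite j0 -ltnS jn => /(_ isT) cj.
  by rewrite /tilde_p; case: ifP => _; apply: p_ge0 => //; lia.
have cd n j : (0 < j <= n)%N -> (eps j < d j)%N by case/andP => /ed.
have fd := flip_digit d_gt1 ed.
have width n : cyl_right R d eps n - cyl_left R d eps n =
    mass (uniform_weight R d) (flip d eps) n.
  by rewrite /cyl_right addrC addKr.
have uP := uniform_pos_weights R d_gt1.
(* [d 1 * ... * d n] is the inverse of the length of the cylinder. *)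
rewrite [X in X @ _ --> _](_ : _ = fun n =>
  ((tildeF d p (cyl_right R d eps n) - tildeF d p (cyl_left R d eps n)) /
   (cyl_right R d eps n - cyl_left R d eps n))%:E); last first.
  apply/funext => n; rewrite (tildeF_increment d_gt1 (@cd n) pP) width.
  by rewrite big_split /= prod_tilde_pE mass_uniform invrK mulrC.
apply: straddle_slope_cvg fl _ _ _ _ => [n|n|n|].
- have [/andP[-> _] _] := cyl_left_in R d_gt1 (@cd n).
  by have [/andP[_ ->] _] := cyl_right_in R d_gt1 (@cd n).
- apply: (cylinder_itv d_gt1 (c := eps)); split.
    exact: (nega_repr_itv d_gt1 (eps := eps)).
  by exists eps.
- by rewrite -subr_gt0 width (mass_gt0 uP).
- rewrite (_ : (fun n => _) = mass (uniform_weight R d) (flip d eps)).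
    exact: cvg_mass_uniform.
  by apply/funext => n; rewrite width.
Qed.
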